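(* Let $\gamma\in[0,2]$ and $\omega,n\in\mathbb{R}$ be constants. (a) (Einstein-massless-scalar cosmology.) Let $H(t)>0$, $\rho_m(t)$, $\varphi(t)$ be smooth functions of cosmic time $t$ on an interval satisfying $$3H^2=\rho_m+\tfrac12\dot\varphi^2,\quad 2\dot H=-\gamma\rho_m-\dot\varphi^2,\quad \ddot\varphi+3H\dot\varphi=0,\quad \dot\rho_m+3\gamma H\rho_m=0 .$$ Then $\Omega_m:=\rho_m/(3H^2)$ satisfies $$\Omega_m'=3(2-\gamma)\,\Omega_m(1-\Omega_m).$$ (b) (Sáez-Ballester cosmology.) Let $H(t)>0$, $\rho_m(t)$, $\phi(t)>0$ be smooth functions of cosmic time $t$ on an interval satisfying $$3H^2=\rho_m+\tfrac{\omega}{2}\phi^n\dot\phi^2,\quad 2\dot H=-\gamma\rho_m-\omega\phi^n\dot\phi^2,\quad \ddot\phi+3H\dot\phi+\tfrac n2\frac{\dot\phi^2}{\phi}=0,\quad \dot\rho_m+3\gamma H\rho_m=0 .$$ Then $\Omega_m:=\rho_m/(3H^2)$ satisfies the same autonomous equation $$\Omega_m'=3(2-\gamma)\,\Omega_m(1-\Omega_m),$$ independently of $\omega$ and $n$.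
   Context: Dots denote derivatives with respect to cosmic time $t$; the prime denotes the derivative with respect to $\tau=\int H\,dt$, i.e. $f'=\dot f/H$. These are the equations of motion, for a flat Friedmann-Robertson-Walker metric with Hubble parameter $H$ (expanding universe) and a barotropic fluid of energy density $\rho_m$ and pressure $p_m=(\gamma-1)\rho_m$, of general relativity with a minimally coupled massless scalar $\varphi$ (part (a)) and of Sáez-Ballester theory with scalar $\phi$ and parameters $\omega,n$ (part (b)). *)

(* Defs.v *)
From Stdlib Require Import Reals.
Open Scope R_scope.

(* Nondegenerate intervals, with or without endpoints, bounded or not. *)
Definition is_interval (J : R -> Prop) : Prop :=
  (forall a b x : R, J a -> J b -> a <= x <= b -> J x) /\
  (exists a b : R, J a /\ J b /\ a < b).

(* [D_in f df J t] takes the limit of the difference quotient inside [J], so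
   that derivatives at an endpoint belonging to [J] are one-sided and values
   of [f] outside [J] are irrelevant.  On a nondegenerate interval [df] is
   determined on [J] by [f]. *)
Definition derivative_on (J : R -> Prop) (f df : R -> R) : Prop :=
  forall t : R, J t -> D_in f df J t.

(* [F k] is the [k]-th derivative of [f] on [J]. *)
Definition smooth_on (J : R -> Prop) (f : R -> R) : Prop :=
  exists F : nat -> R -> R,
    (forall t : R, J t -> F O t = f t) /\
    (forall k : nat, derivative_on J (F k) (F (S k))).

(* [g] is the derivative of [f] with respect to [tau = \int H dt], that is,
   [f] is differentiable in [t] and [g = (df/dt) / H]. *)
Definition tau_derivative_on (J : R -> Prop) (H f g : R -> R) : Prop :=
  exists df : R -> R,
    derivative_on J f df /\ (forall t : R, J t -> g t = df t / H t).

Definition Omega_m (H rho : R -> R) (t : R) : R := rho t / (3 * H t ^ 2).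

Definition Omega_m_equation (J : R -> Prop) (gamma : R) (H rho : R -> R) : Prop :=
  tau_derivative_on J H (Omega_m H rho)
    (fun t => 3 * (2 - gamma) * Omega_m H rho t * (1 - Omega_m H rho t)).

(* Main.v *)
Require Import Defs.
From Stdlib Require Import Reals Lra.
Open Scope R_scope.

(** Both theories have the form 3 H^2 = rho + K, 2 H' = - gamma rho - 2 K with K
    the kinetic energy of the scalar.  Eliminating K gives
    2 H' = (2 - gamma) rho - 6 H^2, which together with the continuity equation
    for rho determines the derivative of rho / (3 H^2). *)

Lemma limit1_in_ext_in (f g : R -> R) (D : R -> Prop) (l x0 : R) :
  (forall x, D x -> f x = g x) -> limit1_in f D l x0 -> limit1_in g D l x0.
Proof.
  intros Hfg Hf eps Heps.
  destruct (Hf eps Heps) as [alp [Halp Hlim]].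
  exists alp; split; [exact Halp|].
  intros x [HDx Hx]; rewrite <- (Hfg x HDx); apply Hlim; split; assumption.
Qed.

(** The difference quotient of [/ f] factors as minus that of [f] times [/ f x * / f x0].
    Differentiability gives continuity within [D], so [/ f x] tends to [/ f x0]. Since [f] has no
    zero on [D], the factorization holds at every point where the limit is taken. *)
Lemma D_in_inv (f df : R -> R) (D : R -> Prop) (x0 : R) :
  (forall x, D x -> f x <> 0) -> f x0 <> 0 ->
  D_in f df D x0 ->
  D_in (fun x => / f x) (fun x => - df x / f x ^ 2) D x0.
Proof.
  intros Hne Hne0 Hf.
  pose proof (limit_inv _ _ _ _ (cont_deriv _ _ _ _ Hf) Hne0) as Hinv.
  pose proof (limit_mul _ _ _ _ _ _ (limit_Ropp _ _ _ _ Hf)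
    (limit_mul _ _ _ _ _ _ Hinv (limit_free (fun _ => / f x0) (D_x D x0) x0 x0)))
    as Hlim.
  unfold D_in.
  replace (- df x0 / f x0 ^ 2) with (- df x0 * (/ f x0 * / f x0))
    by (field; assumption).
  refine (limit1_in_ext_in _ _ _ _ _ _ Hlim).
  intros x [HDx Hx]; field.
  repeat split; auto; lra.
Qed.

(** Leaving [K] arbitrary lets one statement serve both theories. *)
Lemma Omega_m_equation_of_energy (J : R -> Prop) (gamma : R)
    (H rho dH drho K : R -> R) :
  (forall t, J t -> 0 < H t) ->
  derivative_on J H dH ->
  derivative_on J rho drho ->
  (forall t, J t -> 3 * H t ^ 2 = rho t + K t) ->
  (forall t, J t -> 2 * dH t = - gamma * rho t - 2 * K t) ->
  (forall t, J t -> drho t + 3 * gamma * H t * rho t = 0) ->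
  Omega_m_equation J gamma H rho.
Proof.
  intros HH DH Drho Fried Raych Cont.
  assert (Hne : forall t, J t -> 3 * (H t * H t) <> 0).
  { intros t Ht; specialize (HH t Ht).
    assert (0 < H t * H t) by (apply Rmult_lt_0_compat; assumption); lra. }
  (* The derivative of [rho * / (3 * (H * H))], left in the unsimplified shape that [Dmult],
     [Dmult_const] and [D_in_inv] produce, so that it matches their result by conversion. *)
  exists (fun t => drho t * / (3 * (H t * H t))
    + rho t * (- (3 * (dH t * H t + H t * dH t)) / (3 * (H t * H t)) ^ 2)).
  split.
  - intros t Ht.
    pose proof (Dmult_const _ _ _ _ 3 (Dmult _ _ _ _ _ _ (DH t Ht) (DH t Ht))) as DH2.
    pose proof (Dmult _ _ _ _ _ _ (Drho t Ht) (D_in_inv _ _ _ _ Hne (Hne t Ht) DH2))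
      as DOm.
    refine (limit1_in_ext_in _ _ _ _ _ _ DOm).
    (* The two quotients differ only in that [H x ^ 2] unfolds to [H x * (H x * 1)]. *)
    intros x _; unfold Omega_m, Rdiv; simpl; now rewrite !Rmult_1_r.
  - intros t Ht.
    specialize (HH t Ht); specialize (Fried t Ht); specialize (Raych t Ht);
      specialize (Cont t Ht).
    (* Once both derivatives are replaced, the goal is a rational identity in [gamma], [rho t] and
       [H t], with [H t] nonzero. *)
    replace (drho t) with (- 3 * gamma * H t * rho t) by lra.
    replace (dH t) with (((2 - gamma) * rho t - 6 * H t ^ 2) / 2) by lra.
    unfold Omega_m; field; lra.
Qed.

Theorem mainTheorem1 (gamma omega n : R) (hgamma : 0 <= gamma <= 2) :
  (forall (J : R -> Prop) (H rho phi dH drho dphi ddphi : R -> R),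
     is_interval J ->
     smooth_on J H -> smooth_on J rho -> smooth_on J phi ->
     (forall t : R, J t -> 0 < H t) ->
     derivative_on J H dH ->
     derivative_on J rho drho ->
     derivative_on J phi dphi ->
     derivative_on J dphi ddphi ->
     (forall t : R, J t -> 3 * H t ^ 2 = rho t + 1 / 2 * dphi t ^ 2) ->
     (forall t : R, J t -> 2 * dH t = - gamma * rho t - dphi t ^ 2) ->
     (forall t : R, J t -> ddphi t + 3 * H t * dphi t = 0) ->
     (forall t : R, J t -> drho t + 3 * gamma * H t * rho t = 0) ->
     Omega_m_equation J gamma H rho)
  /\
  (forall (J : R -> Prop) (H rho phi dH drho dphi ddphi : R -> R),
     is_interval J ->
     smooth_on J H -> smooth_on J rho -> smooth_on J phi ->
     (forall t : R, J t -> 0 < H t) ->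
     (forall t : R, J t -> 0 < phi t) ->
     derivative_on J H dH ->
     derivative_on J rho drho ->
     derivative_on J phi dphi ->
     derivative_on J dphi ddphi ->
     (forall t : R, J t ->
        3 * H t ^ 2 = rho t + omega / 2 * Rpower (phi t) n * dphi t ^ 2) ->
     (forall t : R, J t ->
        2 * dH t = - gamma * rho t - omega * Rpower (phi t) n * dphi t ^ 2) ->
     (forall t : R, J t ->
        ddphi t + 3 * H t * dphi t + n / 2 * (dphi t ^ 2 / phi t) = 0) ->
     (forall t : R, J t -> drho t + 3 * gamma * H t * rho t = 0) ->
     Omega_m_equation J gamma H rho).
Proof.
  split.
  - intros J H rho phi dH drho dphi ddphi _ _ _ _ HH DH Drho _ _ Fried Raych _ Cont.
    apply (Omega_m_equation_of_energy J gamma H rho dH drho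
             (fun t => 1 / 2 * dphi t ^ 2)); auto.
    intros t Ht; rewrite (Raych t Ht); field.
  - intros J H rho phi dH drho dphi ddphi _ _ _ _ HH _ DH Drho _ _ Fried Raych _ Cont.
    (* The coupling [omega] and the power of [phi] enter both gravitational equations only through
       this [K], whence the independence of [omega] and [n]. *)
    apply (Omega_m_equation_of_energy J gamma H rho dH drho
             (fun t => omega / 2 * Rpower (phi t) n * dphi t ^ 2)); auto.
    intros t Ht; rewrite (Raych t Ht); field.
Qed.
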